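(* Let $\mathsf{F}$ be a finitely generated free group, $N$ a normal subgroup of $\mathsf{F}$, $G=\mathsf{F}/N$, and let $S\subseteq\mathsf{F}$ be a symmetric (possibly infinite) set whose image in $G$ normally generates $G$. Let $\|\cdot\|_N$ be the invariant word norm on $G$ defined by $S$. Consider the following conditions. 1. The normed group $(G,\|\cdot\|_N)$ is RF as a normed group. 2. The normed group $(G,\|\cdot\|_N)$ is metrically RF. 3. For any $m\in\mathbb{N}$ the set $B^G_m(1)=\{g\in G : \|g\|_N\le m\}$ is closed in the profinite topology of $G$. 4. For any $m\in\mathbb{N}$ and any $w\in \mathsf{F}\setminus B^{\mathsf{F},\|\cdot\|}_m(1)N$ there is a homomorphism $\hat\varphi$ from $\mathsf{F}$ to a finite group such that $\hat\varphi(w)\notin\hat\varphi(B^{\mathsf{F},\|\cdot\|}_m(1)N)$ and $\hat\varphi(N)=1$. Then $2\Rightarrow 3\Rightarrow 4\Rightarrow 1$, and, assuming that $S$ is finite, $1\Leftrightarrow 2$.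
   Context: Norms. An invariant norm on a group $G$ is a function $\ell:G\to[0,\infty)$ with $\ell(g)=0$ iff $g=1$, $\ell(g)=\ell(g^{-1})$, $\ell(gh)\le \ell(g)+\ell(h)$ and $\ell(h^{-1}gh)=\ell(g)$ for all $g,h\in G$. A homomorphism $\phi:(G_1,\ell_1)\to(G_2,\ell_2)$ of normed groups is metric if $\ell_2(\phi(h))\le\ell_1(h)$ for all $h\in G_1$. Almost homomorphisms. Let $D\subseteq G_1$ be finite and $Q\subset\mathbb{Q}\cap[0,\infty)$ be finite with $0\in Q$. A map $\varphi:G_1\to G_2$ is a $D$-$Q$-almost-homomorphism of normed groups $(G_1,\ell_1)$, $(G_2,\ell_2)$ if $\varphi$ is injective on $D$; $\varphi(hg)=\varphi(h)\varphi(g)$ whenever $h,g,hg\in D$; and for all $g\in D$, $q\in Q$ and each relation $\square\in\{<,>,=\}$ one has $\ell_1(g)\,\square\, q\Leftrightarrow\ell_2(\varphi(g))\,\square\, q$. RF. An invariantly normed group $(G,\ell)$ is RF as a normed group (resp. metrically RF) if for every finite $D\subseteq G$ and every finite $Q\subset\mathbb{Q}\cap[0,\infty)$ with $0\in Q$ there are a finite group $C$ with an invariant norm $\ell_C$ and a group homomorphism (resp. a metric homomorphism) $\varphi:(G,\ell)\to (C,\ell_C)$ which is a $D$-$Q$-almost-homomorphism. Word norms and balls. $S$ symmetric means $S=S^{-1}$; $S^{\mathsf{F}}$ is the set of all $\mathsf{F}$-conjugates of elements of $S$; ''normally generates'' means that the conjugates of the image of $S$ generate $G$. On the subgroup $\langle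 S^{\mathsf{F}}\rangle$ of $\mathsf{F}$, $\|g\|$ is the least $k\ge 0$ such that $g$ is a product of $k$ elements of $S^{\mathsf{F}}$ (so $\|1\|=0$), and $B^{\mathsf{F},\|\cdot\|}_m(1)=\{g\in\langle S^{\mathsf{F}}\rangle:\|g\|\le m\}$, so $B^{\mathsf{F},\|\cdot\|}_0(1)=\{1\}$. On $G=\mathsf{F}/N$, $\|x\|_N$ is the least $k\ge0$ such that $x$ is a product of $k$ elements of the image of $S^{\mathsf{F}}$ in $G$. Products of subsets are element-wise. $\mathbb{N}=\{0,1,2,\ldots\}$. The profinite topology of a group has as basis of open sets the cosets of normal subgroups of finite index. *)

(* Defs.v *)
From HB Require Import structures.
From mathcomp Require Import all_boot all_order ssralg ssrnum rat fingroup.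
From mathcomp Require Import boolp classical_sets functions cardinality.
From mathcomp Require Import reals topology.
From mathcomp Require Import generic_quotient.

Set Implicit Arguments.
Unset Strict Implicit.
Unset Printing Implicit Defensive.

Import Order.TTheory GRing.Theory Num.Theory.

Local Open Scope classical_set_scope.
Local Open Scope quotient_scope.
Local Open Scope group_scope.

Section Subsets.
Context {G : groupType}.
Implicit Types (A B K : set G) (x : G).

Definition subgroup K : Prop :=
  [/\ K 1, (forall x y, K x -> K y -> K (x * y)) & forall x, K x -> K x^-1].

Definition normal_subgroup K : Prop :=
  subgroup K /\ forall x y, K x -> K (x ^ y).

Definition generated_subgroup A : set G := smallest subgroup A.

Definition symmetric_set A : Prop := [set x^-1 | x in A] = A.

Definition conjugate_closure A : set G := [set x ^ y | x in A & y in [set: G]].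

Definition set_mul A B : set G := [set x * y | x in A & y in B].

Definition left_coset x K : set G := [set x * y | y in K].

Definition finite_index K : Prop :=
  finite_set [set left_coset x K | x in [set: G]].

Definition words A (k : nat) : set G :=
  [set x | exists s : seq G,
     [/\ size s = k, (forall y, y \in s -> A y) & x = \prod_(y <- s) y]].

(* The least length of a product of elements of A equal to x. For symmetric A
   it exists exactly when x lies in the subgroup generated by A; the default
   value 0 outside this subgroup is irrelevant. *)
Definition word_norm A x : nat :=
  xget 0%N [set k | words A k x /\ forall j, words A j x -> (k <= j)%N].

Definition word_ball A (m : nat) : set G :=
  [set x | generated_subgroup A x /\ (word_norm A x <= m)%N].

End Subsets.

Definition finitely_generated (G : groupType) : Prop :=
  exists2 A : set G, finite_set A & generated_subgroup A = [set: G].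

(* B is a basis when every function from B to a group H, given here as the
   restriction to B of some f : F -> H, extends uniquely to a homomorphism. *)
Definition free_basis (F : groupType) (B : set F) : Prop :=
  forall (H : groupType) (f : F -> H),
    exists2 phi : {multiplicative F -> H},
      {in B, phi =1 f} &
      forall psi : {multiplicative F -> H}, {in B, psi =1 f} -> psi =1 phi.

Definition free_group (F : groupType) : Prop :=
  exists B : set F, free_basis B.

Record normalSubgroup (F : groupType) := NormalSubgroup {
  normal_carrier :> set F;
  normal_carrierP : normal_subgroup normal_carrier
}.

Section Quotient.
Context {F : groupType} (N : normalSubgroup F).

Definition coset_rel : rel F := fun x y => x^-1 * y \in (N : set F).

Lemma coset_rel_equiv : equiv_class_of coset_rel.
Proof.
case: (normal_carrierP N) => -[N1 NM NV] _; split.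
- by move=> x; rewrite /coset_rel mulVg; apply/mem_set.
- by move=> x y; apply/idP/idP => /set_mem/NV H; apply/mem_set;
    move: H; rewrite invgM invgK.
- move=> y x z /set_mem xy /set_mem yz; apply/mem_set.
  by have := NM _ _ xy yz; rewrite mulgA mulgK.
Qed.

Canonical coset_equiv := EquivRelPack coset_rel_equiv.

Definition quotient_group := {eq_quot coset_equiv}.

HB.instance Definition _ := Choice.on quotient_group.

Definition quotient_proj (x : F) : quotient_group :=
  \pi_({eq_quot coset_equiv}) x.

Lemma quotient_projP x y :
  quotient_proj x = quotient_proj y <-> (N : set F) (x^-1 * y).
Proof.
split; first by move=> /eqmodP/set_mem.
by move=> h; apply/eqmodP/mem_set.
Qed.

Lemma quotient_proj_surj (q : quotient_group) : exists x, quotient_proj x = q.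
Proof. by exists (repr (q : {eq_quot coset_equiv})); apply: reprK. Qed.

Let lift (q : quotient_group) : F := repr (q : {eq_quot coset_equiv}).

Let liftK q : quotient_proj (lift q) = q.
Proof. exact: reprK. Qed.

Definition quotient_mul (p q : quotient_group) : quotient_group :=
  quotient_proj (repr (p : {eq_quot coset_equiv}) *
                 repr (q : {eq_quot coset_equiv})).
Definition quotient_inv (p : quotient_group) : quotient_group :=
  quotient_proj (repr (p : {eq_quot coset_equiv}))^-1.

Lemma quotient_mulE x y :
  quotient_mul (quotient_proj x) (quotient_proj y) = quotient_proj (x * y).
Proof.
case: (normal_carrierP N) => -[N1 NM NV] NJ.
apply/quotient_projP.
have /quotient_projP hx := liftK (quotient_proj x).
have /quotient_projP hy := liftK (quotient_proj y).
rewrite -/(lift _) -/(lift (quotient_proj y)).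
have := NM _ _ (NJ _ (lift (quotient_proj y)) hx) hy.
by rewrite /conjg invgM !mulgA mulgK.
Qed.

Lemma quotient_invE x : quotient_inv (quotient_proj x) = quotient_proj x^-1.
Proof.
case: (normal_carrierP N) => -[N1 NM NV] NJ.
apply/quotient_projP; rewrite invgK -/(lift _).
have /quotient_projP hx := liftK (quotient_proj x).
have := NJ _ (lift (quotient_proj x))^-1 (NV _ hx).
by rewrite /conjg invgM !invgK !mulgA mulgK.
Qed.

Let mulA : associative quotient_mul.
Proof.
move=> p q r; rewrite -(liftK p) -(liftK q) -(liftK r).
by rewrite !quotient_mulE mulgA.
Qed.

Let mul1 : left_id (quotient_proj 1) quotient_mul.
Proof. by move=> p; rewrite -(liftK p) quotient_mulE mul1g. Qed.

Let mulr1 : right_id (quotient_proj 1) quotient_mul.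
Proof. by move=> p; rewrite -(liftK p) quotient_mulE mulg1. Qed.

Let mulV : left_inverse (quotient_proj 1) quotient_inv quotient_mul.
Proof. by move=> p; rewrite -(liftK p) quotient_invE quotient_mulE mulVg. Qed.

Let mulrV : right_inverse (quotient_proj 1) quotient_inv quotient_mul.
Proof. by move=> p; rewrite -(liftK p) quotient_invE quotient_mulE mulgV. Qed.

HB.instance Definition _ :=
  isGroup.Build quotient_group mulA mul1 mulr1 mulV mulrV.

HB.instance Definition _ :=
  isMultiplicative.Build F quotient_group quotient_proj
    (fun x y => esym (quotient_mulE x y)).

End Quotient.

(* The group G equipped with its profinite topology. *)
Definition profinite (G : groupType) : Type := G.

Section Profinite.
Context {G : groupType}.

Definition profinite_basis : set (set (profinite G)) :=
  [set U | exists K : set G, [/\ normal_subgroup K, finite_index K &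
             exists x, U = left_coset x K]].

Let left_cosetE (K : set G) x y : left_coset x K y <-> K (x^-1 * y).
Proof.
split; first by case=> z Kz <-; rewrite mulKg.
by move=> Ky; exists (x^-1 * y) => //; rewrite mulVKg.
Qed.

Let basis_cover : \bigcup_(U in profinite_basis) U = setT.
Proof.
rewrite -subTset => x _; exists setT => //.
have cT y : left_coset y [set: G] = setT.
  by rewrite -subTset => z _; apply/left_cosetE.
exists setT; split; [by split | | by exists 1; rewrite cT].
apply: (@sub_finite_set _ _ [set [set: G]]); last exact: finite_set1.
by move=> _ [y _ <-]; rewrite cT.
Qed.

Let basis_join (U V : set (profinite G)) (t : profinite G) :
  profinite_basis U -> profinite_basis V -> U t -> V t ->
  exists W : set (profinite G),
    [/\ profinite_basis W, W t & W `<=` U `&` V].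
Proof.
case=> K [[[K1 KM KV] KJ] Kf [x ->]] [L [[[L1 LM LV] LJ] Lf [y ->]]].
move=> /left_cosetE xt /left_cosetE yt.
have IE z : left_coset z (K `&` L) = left_coset z K `&` left_coset z L.
  apply/seteqP; split=> u.
    by move=> /left_cosetE[a b]; split; apply/left_cosetE.
  by move=> [/left_cosetE a /left_cosetE b]; apply/left_cosetE; split.
exists (left_coset t (K `&` L)); split.
- exists (K `&` L); split; last by exists t.
  + split; last by move=> a b [Ka La]; split; [exact: KJ | exact: LJ].
    split; [by [] | |].
      by move=> a b [? ?] [? ?]; split; [exact: KM | exact: LM].
    by move=> a [? ?]; split; [exact: KV | exact: LV].
  + apply: sub_finite_set (finite_image2 (@setI G) Kf Lf).
    move=> _ [z _ <-]; rewrite IE.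
    by exists (left_coset z K); [exists z | exists (left_coset z L) => //; exists z].
- by apply/left_cosetE; rewrite mulVg.
- move=> u /left_cosetE[Ku Lu]; split; apply/left_cosetE.
    by have := KM _ _ xt Ku; rewrite mulgA mulgK.
  by have := LM _ _ yt Lu; rewrite mulgA mulgK.
Qed.

HB.instance Definition _ := Choice.on (profinite G).

HB.instance Definition _ := isBaseTopological.Build (profinite G)
  (b := fun U : set (profinite G) => U) basis_cover basis_join.

End Profinite.

Section NormedGroups.
Context {R : realType}.
Local Open Scope ring_scope.

Definition invariant_norm (G : groupType) (l : G -> R) : Prop :=
  [/\ forall g, 0 <= l g,
      forall g, l g = 0 <-> g = 1%g,
      forall g, l g = l g^-1%g,
      forall g h, l (g * h)%g <= l g + l h &
      forall g h, l (h^-1 * g * h)%g = l g].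

Definition metric_map (G1 G2 : groupType) (l1 : G1 -> R) (l2 : G2 -> R)
    (phi : G1 -> G2) : Prop :=
  forall h, l2 (phi h) <= l1 h.

Definition almost_homomorphism (G1 G2 : groupType) (l1 : G1 -> R)
    (l2 : G2 -> R) (D : set G1) (Q : set rat) (phi : G1 -> G2) : Prop :=
  [/\ {in D &, injective phi},
      forall h g, D h -> D g -> D (h * g)%g -> phi (h * g)%g = (phi h * phi g)%g &
      forall g q, D g -> Q q ->
        [/\ l1 g < ratr q <-> l2 (phi g) < ratr q,
            l1 g > ratr q <-> l2 (phi g) > ratr q &
            l1 g = ratr q <-> l2 (phi g) = ratr q]].

(* Both notions are meant for an invariant norm l. *)
Definition RF_normed (G : groupType) (l : G -> R) : Prop :=
  forall (D : set G) (Q : set rat),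
    finite_set D -> finite_set Q -> Q `<=` [set q | 0 <= q] -> Q 0 ->
    exists (C : finGroupType) (lC : C -> R) (phi : {multiplicative G -> C}),
      invariant_norm lC /\ almost_homomorphism l lC D Q phi.

Definition metrically_RF (G : groupType) (l : G -> R) : Prop :=
  forall (D : set G) (Q : set rat),
    finite_set D -> finite_set Q -> Q `<=` [set q | 0 <= q] -> Q 0 ->
    exists (C : finGroupType) (lC : C -> R) (phi : {multiplicative G -> C}),
      [/\ invariant_norm lC, metric_map l lC phi &
          almost_homomorphism l lC D Q phi].

End NormedGroups.

(* Main.v *)
(** The closed balls and the finite quotients F / L of condition 4 both say that
    each g has a finite-index normal subgroup K of G such that every element of
    gK has norm at least that of g.  Intersecting finitely many such K gives a
    finite quotient C of G on which the word norm of the image of S is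
    automatically below the norm of G, and agrees with it on a prescribed
    finite set; taking the elements h^-1 g in this set makes the quotient map
    injective on D.  Thus condition 4 gives the metric form of RF for every S,
    and hence 4 => 2 => 1.  Conversely, if S is finite, adding S to D and 1 to
    Q forces the images of the elements of S to have norm at most 1, so every
    homomorphism provided by condition 1 is metric by subadditivity. *)

Require Import Defs.
From HB Require Import structures.
From mathcomp Require Import all_boot all_order ssralg ssrnum rat fingroup.
From mathcomp Require Import boolp classical_sets functions cardinality.
From mathcomp Require Import reals topology.

Set Implicit Arguments.
Unset Strict Implicit.
Unset Printing Implicit Defensive.

Import Order.TTheory GRing.Theory Num.Theory.

Local Open Scope classical_set_scope.
Local Open Scope group_scope.

(** * Homomorphisms, symmetric sets and conjugate closures *)

Section Multiplicative.
Context {G H : groupType} (f : {multiplicative G -> H}).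

Lemma multiplicative1 : f 1 = 1.
Proof. by apply: (mulgI (f 1)); rewrite -gmulfM !mulg1. Qed.

Lemma multiplicativeV x : f x^-1 = (f x)^-1.
Proof. by apply: (mulgI (f x)); rewrite -gmulfM !mulgV multiplicative1. Qed.

Lemma multiplicativeJ x y : f (x ^ y) = f x ^ f y.
Proof. by rewrite /conjg !gmulfM multiplicativeV. Qed.

Lemma multiplicative_eq x y : f (x^-1 * y) = 1 <-> f x = f y.
Proof.
rewrite gmulfM multiplicativeV; split=> [|->]; last exact: mulVg.
by move=> /mulg1_eq; rewrite invgK.
Qed.

End Multiplicative.

Lemma symmetricV (G : groupType) (A : set G) x :
  symmetric_set A -> A x -> A x^-1.
Proof. by move=> symA Ax; rewrite -symA; exists x. Qed.

Lemma symmetric_image (G H : groupType) (f : {multiplicative G -> H})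
    (A : set G) :
  symmetric_set A -> symmetric_set (f @` A).
Proof.
move=> symA; apply/seteqP; split=> [_ [_ [x Ax <-] <-]|_ [x Ax <-]].
  by exists x^-1; [exact: symmetricV | rewrite multiplicativeV].
exists (f x^-1); last by rewrite multiplicativeV invgK.
by exists x^-1 => //; exact: symmetricV.
Qed.

Lemma symmetric_conjugate_closure (G : groupType) (A : set G) :
  symmetric_set A -> symmetric_set (conjugate_closure A).
Proof.
move=> symA; apply/seteqP; split=> [_ [_ [x Ax [y _ <-]] <-]|_ [x Ax [y _ <-]]].
  by exists x^-1; [exact: symmetricV | exists y => //; rewrite conjVg].
exists (x^-1 ^ y); last by rewrite conjVg invgK.
by exists x^-1; [exact: symmetricV | exists y].
Qed.

Lemma conjugate_closureJ (G : groupType) (A : set G) x y :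
  conjugate_closure A x -> conjugate_closure A (x ^ y).
Proof.
by case=> a Aa [z _ <-]; exists a => //; exists (z * y) => //; rewrite conjgM.
Qed.

(** Surjectivity lets every conjugating element of [H] be lifted to [G]. *)
Lemma conjugate_closure_image (G H : groupType) (f : {multiplicative G -> H})
    (A : set G) :
  (forall y, exists x, f x = y) ->
  f @` conjugate_closure A = conjugate_closure (f @` A).
Proof.
move=> f_surj; apply/seteqP; split.
  move=> _ [_ [a Aa [z _ <-]] <-]; exists (f a); first by exists a.
  by exists (f z) => //; rewrite multiplicativeJ.
move=> _ [_ [a Aa <-] [y _ <-]]; have [z <-] := f_surj y.
by exists (a ^ z); [exists a => //; exists z | rewrite multiplicativeJ].
Qed.

(** * Words, the word norm and its balls *)

Section Words.
Context {G : groupType} (A : set G).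
Implicit Types (x y : G) (j k m : nat).

Lemma words0 : words A 0 1.
Proof. by exists [::]; split; rewrite ?big_nil. Qed.

Lemma words1 x : A x -> words A 1 x.
Proof.
move=> Ax; exists [:: x]; split; rewrite ?big_seq1 // => y.
by rewrite inE => /eqP->.
Qed.

Lemma wordsD j k x y : words A j x -> words A k y -> words A (j + k) (x * y).
Proof.
move=> [s [<- sA ->]] [t [<- tA ->]]; exists (s ++ t).
split; rewrite ?size_cat ?big_cat // => z.
by rewrite mem_cat => /orP[/sA|/tA].
Qed.

Lemma words0E x : words A 0 x -> x = 1.
Proof. by case=> s [/size0nil-> _ ->]; rewrite big_nil. Qed.

Lemma wordsS k x :
  words A k.+1 x -> exists y z, [/\ A y, words A k z & x = y * z].
Proof.
case=> -[[]//|y s [/eqP]]; rewrite eqSS => /eqP<- sA ->; exists y, (\prod_(z <- s) z).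
split; rewrite ?big_cons //; first by apply: sA; rewrite mem_head.
by exists s; split=> // z zs; apply: sA; rewrite inE zs orbT.
Qed.

Lemma words_generated k x : words A k x -> generated_subgroup A x.
Proof.
move=> wx K [[K1 KM KV] AK]; elim: k x wx => [x /words0E-> //|k IH x].
by move=> /wordsS[y [z [/AK Ky /IH Kz ->]]]; exact: KM.
Qed.

(** Once some word represents [x], a least length exists by well-ordering, so [xget] returns it and
    not its default value. *)
Lemma word_normP k x : words A k x ->
  words A (word_norm A x) x /\ forall j, words A j x -> word_norm A x <= j.
Proof.
move=> wx; pose P := [set k | words A k x /\ forall j, words A j x -> k <= j].
suff /(xgetPex 0) : exists k, P k by [].
have ex : exists k, `[< words A k x >] by exists k; apply/asboolP.
have [m /asboolP wm m_min] := ex_minnP ex.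
by exists m; split=> // j /asboolP/m_min.
Qed.

Lemma word_norm_le k x : words A k x -> word_norm A x <= k.
Proof. by move=> wx; exact: (word_normP wx).2 wx. Qed.

Lemma word_norm1 : word_norm A 1 = 0%N.
Proof. by apply/eqP; rewrite -leqn0; apply: word_norm_le; exact: words0. Qed.

Section Symmetric.
Hypothesis symA : symmetric_set A.

Lemma wordsV k x : words A k x -> words A k x^-1.
Proof.
elim: k x => [_ /words0E->|k IH _ /wordsS[y [z [Ay /IH wz ->]]]].
  by rewrite invg1; exact: words0.
by rewrite invgM -addn1; apply: wordsD => //; apply: words1; exact: symmetricV.
Qed.

(** The elements represented by words form a subgroup containing [A]; symmetry gives closure under
    inverses. *)
Lemma generated_words x : generated_subgroup A x -> exists k, words A k x.
Proof.
move=> /(_ [set y | exists k, words A k y]); apply.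
split; last by move=> y Ay; exists 1%N; exact: words1.
split; first by exists 0%N; exact: words0.
- by move=> y z [j wy] [k wz]; exists (j + k)%N; exact: wordsD.
- by move=> y [k wy]; exists k; exact: wordsV.
Qed.

Lemma word_ballP m x : word_ball A m x <-> exists2 k, k <= m & words A k x.
Proof.
split=> [[/generated_words[k wx] le_m]|[k le_m wx]].
  by exists (word_norm A x) => //; exact: (word_normP wx).1.
split; first exact: words_generated wx.
exact: leq_trans (word_norm_le wx) le_m.
Qed.

End Symmetric.

Lemma wordsJ k x y :
  (forall u v, A u -> A (u ^ v)) -> words A k x -> words A k (x ^ y).
Proof.
move=> AJ; elim: k x => [_ /words0E->|k IH _ /wordsS[u [v [Au /IH wv ->]]]].
  by rewrite conj1g; exact: words0.
by rewrite conjMg -add1n; apply: wordsD => //; exact/words1/AJ.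
Qed.

Section Generating.
Hypotheses (symA : symmetric_set A) (AJ : forall x y, A x -> A (x ^ y)).
Hypothesis genA : generated_subgroup A = [set: G].

(** Since [A] generates, every element is represented by a word, and the norm is attained
    everywhere. *)
Lemma words_word_norm x : words A (word_norm A x) x.
Proof.
have [|k] := @generated_words symA x; first by rewrite genA.
by move=> /word_normP[].
Qed.

Lemma word_normM x y : word_norm A (x * y) <= word_norm A x + word_norm A y.
Proof. by apply: word_norm_le; apply: wordsD; exact: words_word_norm. Qed.

Lemma word_norm_eq0 x : word_norm A x = 0%N -> x = 1.
Proof. by move=> x0; apply: words0E; rewrite -x0; exact: words_word_norm. Qed.

Lemma word_normV x : word_norm A x^-1 = word_norm A x.
Proof.
have le y : word_norm A y^-1 <= word_norm A y.
  by apply: word_norm_le; apply: wordsV => //; exact: words_word_norm.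
by apply/eqP; rewrite eqn_leq le -{1}[x]invgK le.
Qed.

Lemma word_normJ x y : word_norm A (x ^ y) = word_norm A x.
Proof.
have le u v : word_norm A (u ^ v) <= word_norm A u.
  by apply: word_norm_le; apply: wordsJ => //; exact: words_word_norm.
by apply/eqP; rewrite eqn_leq le -{1}[x](conjgK y) le.
Qed.

Lemma word_norm_invariant (R : realType) :
  invariant_norm (fun x => (word_norm A x)%:R%R : R).
Proof.
split=> [x|x|x|x y|x y].
- exact: ler0n.
- split=> [/eqP|->]; last by rewrite word_norm1.
  by rewrite pnatr_eq0 => /eqP/word_norm_eq0.
- by rewrite word_normV.
- by rewrite -natrD ler_nat word_normM.
- by rewrite -mulgA -conjgE word_normJ.
Qed.

End Generating.
End Words.

(** A word in the images lifts letter by letter to a word of the same length. This is how norms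
    upstairs and downstairs get compared. *)
Lemma words_image (G H : groupType) (f : {multiplicative G -> H}) (A : set G)
    k y :
  words (f @` A) k y <-> exists2 x, words A k x & f x = y.
Proof.
split; elim: k y => [|k IH] y.
- by move=> /words0E->; exists 1; [exact: words0 | rewrite multiplicative1].
- move=> /wordsS[_ [_ [[a Aa <-] /IH[x wx <-] ->]]]; exists (a * x).
    by rewrite -add1n; apply: wordsD => //; exact: words1.
  exact: gmulfM.
- by move=> [_ /words0E-> <-]; rewrite multiplicative1; exact: words0.
- move=> [_ /wordsS[a [x [Aa wx ->]]] <-]; rewrite gmulfM -add1n.
  by apply: wordsD; [apply: words1; exists a | apply: IH; exists x].
Qed.

Lemma image_generates (G H : groupType) (f : {multiplicative G -> H})
    (A : set G) :
  (forall y, exists x, f x = y) -> symmetric_set A ->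
  generated_subgroup A = [set: G] -> generated_subgroup (f @` A) = [set: H].
Proof.
move=> f_surj symA genA; rewrite -subTset => y _; have [x <-] := f_surj y.
apply: (@words_generated _ _ (word_norm A x)); apply/words_image.
by exists x => //; exact: words_word_norm.
Qed.

(** * Finite-index normal subgroups, finite quotients and separation *)

Section FiniteIndex.
Context {G : groupType}.
Implicit Types (K L : set G) (x y : G).

Lemma left_cosetP K x y : left_coset x K y <-> K (x^-1 * y).
Proof.
split; first by case=> z Kz <-; rewrite mulKg.
by move=> Ky; exists (x^-1 * y) => //; rewrite mulVKg.
Qed.

Lemma normal_subgroupT : normal_subgroup [set: G].
Proof. by []. Qed.

Lemma finite_indexT : finite_index [set: G].
Proof.
apply: (@sub_finite_set _ _ [set [set: G]]); last exact: finite_set1.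
by move=> _ [y _ <-]; rewrite /= -subTset => z _; exact/left_cosetP.
Qed.

Lemma normal_subgroupI K L :
  normal_subgroup K -> normal_subgroup L -> normal_subgroup (K `&` L).
Proof.
move=> [[K1 KM KV] KJ] [[L1 LM LV] LJ].
split; last by move=> x y [/KJ Kx /LJ Lx].
split=> [|x y [Kx Lx] [Ky Ly]|x [/KV Kx /LV Lx]] //.
by split; [exact: KM | exact: LM].
Qed.

Lemma finite_indexI K L :
  finite_index K -> finite_index L -> finite_index (K `&` L).
Proof.
move=> Kf Lf; apply: sub_finite_set (finite_image2 (@setI G) Kf Lf).
move=> _ [x _ <-]; exists (left_coset x K); first by exists x.
exists (left_coset x L); first by exists x.
apply/seteqP; split=> y.
  by move=> [/left_cosetP Ky /left_cosetP Ly]; apply/left_cosetP.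
by move=> /left_cosetP[Ky Ly]; split; apply/left_cosetP.
Qed.

Lemma normal_subgroup_kernel (H : groupType) (f : {multiplicative G -> H}) :
  normal_subgroup [set x | f x = 1].
Proof.
split; last by move=> x y /= fx; rewrite multiplicativeJ fx conj1g.
split=> [|x y /= fx fy|x /= fx]; first by rewrite /= multiplicative1.
  by rewrite gmulfM fx fy mulg1.
by rewrite multiplicativeV fx invg1.
Qed.

(** The cosets of the kernel are fibres of [f], hence are indexed by elements of the finite group
    [C]. *)
Lemma finite_index_kernel (C : finGroupType) (f : {multiplicative G -> C}) :
  finite_index [set x | f x = 1].
Proof.
apply: (@sub_finite_set _ _ ((fun c => f @^-1` [set c]) @` [set: C])).
  move=> _ [x _ <-]; exists (f x) => //; apply/seteqP.
  split=> y /= => [/esym/multiplicative_eq|/left_cosetP/multiplicative_eq//].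
  by move=> fxy; apply/left_cosetP.
exact/finite_image/finite_finset.
Qed.

End FiniteIndex.

(** An enumeration [s] of the carrier supplies the countable and finite structures; [C] is [H]
    itself with these added, and the bijection is the identity. *)
Lemma finite_groupType (H : groupType) :
  finite_set [set: H] ->
  exists (C : finGroupType) (f : {multiplicative H -> C}), bijective f.
Proof.
move=> /finite_seqP[s sE].
have ins x : x \in s by have : [set: H] x by []; rewrite sE.
have indexK : pcancel (index^~ s) (onth s).
  by move=> x; rewrite onthE (nth_map x) ?index_mem ?nth_index.
have enumP : Finite.axiom (undup s).
  by move=> x; rewrite count_uniq_mem ?undup_uniq // mem_undup ins.
pose cM := PCanIsCountable indexK.
pose cT : countType := HB.pack (H : Type) (Choice.class H) cM.
pose fM := isFinite.Build cT enumP.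
pose C : finGroupType := HB.pack (H : Type) (Group.class H) cM fM.
have idM : {morph (id : H -> C) : x y / x * y} by [].
pose fmM := isMultiplicative.Build H C id idM.
pose f : {multiplicative H -> C} := HB.pack (id : H -> C) fmM.
by exists C, f; exists id.
Qed.

Lemma finite_quotient (G : groupType) (K : set G) :
  normal_subgroup K -> finite_index K ->
  exists (C : finGroupType) (f : {multiplicative G -> C}),
    (forall c, exists x, f x = c) /\ (forall x y, f x = f y <-> K (x^-1 * y)).
Proof.
move=> nK Kf; pose NK := NormalSubgroup nK.
have finQ : finite_set [set: quotient_group NK].
  (* The quotient is covered by the finite set of cosets: [xget 1 U] picks a representative of the
     coset [U], which is then projected. *)
  apply: sub_finite_set
    (finite_image (fun U => quotient_proj NK (xget 1 U)) Kf).
  move=> q _; have [x <-] := quotient_proj_surj q.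
  exists (left_coset x K); first by exists x.
  apply/esym/quotient_projP/left_cosetP.
  by apply: (@xgetPex _ 1 (left_coset x K)); exists x; exists 1 => //;
    [by have [[]] := nK | rewrite mulg1].
have [C [f [g fK gK]]] := finite_groupType finQ.
exists C, (f \o @quotient_proj G NK); split=> [c|x y].
  by have [x xE] := quotient_proj_surj (g c); exists x; rewrite /= xE gK.
apply: iff_trans (quotient_projP NK x y).
by split=> [/(can_inj fK)|/= ->].
Qed.

(** On the coset gK the function [l] attains its minimum at g. For a norm this means that gK misses
    every closed ball of radius less than [l g]. *)
Definition finitely_separated (G : groupType) (l : G -> nat) (g : G) : Prop :=
  exists K : set G, [/\ normal_subgroup K, finite_index K &
    forall y, K (g^-1 * y) -> l g <= l y].

Lemma finitely_separated_uniform (G : groupType) (l : G -> nat) (D : set G) :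
  finite_set D -> (forall g, finitely_separated l g) ->
  exists K : set G, [/\ normal_subgroup K, finite_index K &
    forall g, D g -> forall y, K (g^-1 * y) -> l g <= l y].
Proof.
move=> /finite_seqP[s ->] sep; elim: s => [|g s [K [nK Kf Ks]]].
  by exists [set: G]; split; [exact: normal_subgroupT | exact: finite_indexT |].
have [L [nL Lf Lg]] := sep g; exists (K `&` L).
split; [exact: normal_subgroupI | exact: finite_indexI |].
move=> h /=; rewrite inE => /orP[/eqP-> y [_ /Lg]//|hs y [Ky _]].
exact: Ks Ky.
Qed.

(** * Images under surjections, and closed sets of the profinite topology *)

Section Image.
Context {G H : groupType} (f : {multiplicative G -> H}).
Hypothesis f_surj : forall y, exists x, f x = y.

Lemma normal_subgroup_image (K : set G) :
  normal_subgroup K -> normal_subgroup (f @` K).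
Proof.
move=> [[K1 KM KV] KJ]; split; last first.
  move=> _ y [a Ka <-]; have [x <-] := f_surj y.
  by exists (a ^ x); [exact: KJ | rewrite multiplicativeJ].
split=> [|_ _ [a Ka <-] [b Kb <-]|_ [a Ka <-]].
- by exists 1 => //; rewrite multiplicative1.
- by exists (a * b); [exact: KM | rewrite gmulfM].
- by exists a^-1; [exact: KV | rewrite multiplicativeV].
Qed.

Lemma finite_index_image (K : set G) :
  finite_index K -> finite_index (f @` K).
Proof.
move=> /(finite_image (fun U => f @` U)); apply: sub_finite_set.
move=> _ [y _ <-]; have [x <-] := f_surj y.
exists (left_coset x K); first by exists x.
apply/seteqP; split=> z.
  move=> [_ [a Ka <-] <-]; rewrite gmulfM.
  by exists (f a) => //; exists a.
move=> [_ [a Ka <-] <-]; rewrite -gmulfM.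
by exists (x * a) => //; exists a.
Qed.

End Image.

(** A basic coset zK containing x equals xK, so the cosets of x itself suffice to test whether the
    complement of [B] is a neighbourhood of x. *)
Lemma closed_profiniteP (G : groupType) (B : set G) :
  @closed (profinite G) B <->
  forall x, ~ B x -> exists K : set G,
    [/\ normal_subgroup K, finite_index K & forall y, K (x^-1 * y) -> ~ B y].
Proof.
rewrite -openC; split=> [[D' D'basis D'E] x Bx|sepB].
  have [U D'U Ux] : (\bigcup_(U in D') U) x by rewrite D'E.
  have [K [nK Kf [z UE]]] := D'basis _ D'U; exists K; split=> // y Kxy By.
  suff : (\bigcup_(V in D') V) y by rewrite D'E => /(_ By).
  exists U => //; rewrite UE; apply/left_cosetP.
  move: Ux; rewrite UE => /left_cosetP Kzx.
  by case: nK => -[_ KM _] _; have := KM _ _ Kzx Kxy; rewrite mulgA mulgK.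
exists [set U | profinite_basis U /\ U `<=` ~` B]; first by move=> U [].
apply/seteqP; split=> [x [U [_ UB] /UB]//|x /sepB[K [nK Kf KB]]].
exists (left_coset x K); last by apply/left_cosetP; rewrite mulVg; case: nK => -[].
split=> [|y /left_cosetP/KB//].
by exists K; split=> //; exists x.
Qed.

(** * Norm bounds along words, and metric RF from separation *)

Lemma invariant_norm_words (R : realType) (G : groupType) (l : G -> R)
    (B : set G) k x :
  invariant_norm l -> (forall a, B a -> (l a <= 1)%R) -> words B k x ->
  (l x <= k%:R)%R.
Proof.
move=> [_ l1 _ lM _] lB; elim: k x => [_ /words0E->|k IH z /wordsS[a [y []]]].
  by rewrite (l1 1).2.
move=> /lB la /IH ly ->; apply: le_trans (lM _ _) _.
by rewrite -add1n natrD lerD.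
Qed.

(** The finite quotient carries the word norm of the image of [A]. Projection never increases it,
    and separation prevents it from dropping on a given finite set. *)
Lemma metrically_RF_separated (R : realType) (G : groupType) (A : set G) :
  symmetric_set A -> (forall x y, A x -> A (x ^ y)) ->
  generated_subgroup A = [set: G] ->
  (forall g, finitely_separated (word_norm A) g) ->
  metrically_RF (fun g => (word_norm A g)%:R%R : R).
Proof.
move=> symA AJ genA sep D Q Df _ _ _.
(* Elements of [D] are included to preserve their norms, the elements [h^-1 * g] to make [f]
   injective on [D]. *)
pose D' := D `|` [set h^-1 * g | h in D & g in D].
have D'f : finite_set D' by rewrite finite_setU; split=> //; exact: finite_image2.
have [K [nK Kf KD]] := finitely_separated_uniform D'f sep.
have [C [f [f_surj fE]]] := finite_quotient nK Kf.
have symfA := symmetric_image f symA.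
have fAJ x y : (f @` A) x -> (f @` A) (x ^ y).
  move=> [a Aa <-]; have [z <-] := f_surj y.
  by exists (a ^ z); [exact: AJ | rewrite multiplicativeJ].
have genfA := image_generates f_surj symA genA.
have f_le g : word_norm (f @` A) (f g) <= word_norm A g.
  apply/word_norm_le/words_image; exists g => //; exact: words_word_norm.
have f_isom g : D g -> word_norm (f @` A) (f g) = word_norm A g.
  move=> Dg; apply/eqP; rewrite eqn_leq f_le /=.
  (* A shortest word for [f g] lifts to an element [x] of gK with a word of the same length, and [g]
     has least norm in gK. *)
  have /words_image[x wx fx] := words_word_norm symfA genfA (f g).
  apply: leq_trans (word_norm_le wx); apply: (KD _ (or_introl Dg)).
  exact/fE/esym.
exists C, (fun c => (word_norm (f @` A) c)%:R%R), f; split.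
- exact: word_norm_invariant.
- by move=> g; rewrite ler_nat.
split=> [h g /set_mem Dh /set_mem Dg fhg|h g _ _ _|g q Dg _].
(* If [f h = f g], then 1 lies in the coset of [h^-1 * g], so [h^-1 * g] has norm at most that of 1,
   which is 0. *)
- rewrite -[h]invgK; apply/mulg1_eq/(word_norm_eq0 symA genA)/eqP.
  rewrite -leqn0 -(word_norm1 A); apply: (KD (h^-1 * g)).
    by right; exists h => //; exists g.
  by apply/fE; rewrite multiplicative1; apply/multiplicative_eq.
- exact: gmulfM.
- by rewrite f_isom.
Qed.

(** * The implications between the four conditions *)

Theorem theorem3p4 (R : realType) (F : groupType) (N : normalSubgroup F)
    (S : set F) :
  free_group F -> finitely_generated F ->
  symmetric_set S ->
  generated_subgroup (conjugate_closure (quotient_proj N @` S)) =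
    [set: quotient_group N] ->
  let G : groupType := quotient_group N in
  let normN : G -> nat := word_norm (quotient_proj N @` conjugate_closure S) in
  let cond1 := RF_normed (fun g : G => (normN g)%:R%R : R) in
  let cond2 := metrically_RF (fun g : G => (normN g)%:R%R : R) in
  let cond3 := forall m : nat,
    @closed (profinite G) [set g | (normN g <= m)%N] in
  let cond4 := forall (m : nat) (w : F),
    ~ set_mul (word_ball (conjugate_closure S) m) N w ->
    exists (C : finGroupType) (phi : {multiplicative F -> C}),
      ~ (phi @` set_mul (word_ball (conjugate_closure S) m) N) (phi w) /\
      phi @` N = [set 1%g] in
  [/\ (cond2 -> cond3), (cond3 -> cond4), (cond4 -> cond1) &
      (finite_set S -> (cond1 <-> cond2))].
Proof.
move=> _ _ symS genS G normN cond1 cond2 cond3 cond4.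
pose p : {multiplicative F -> G} := @quotient_proj F N.
pose A := p @` conjugate_closure S.
have p_surj y : exists x, p x = y := quotient_proj_surj y.
have AE : A = conjugate_closure (p @` S) by exact: conjugate_closure_image.
have symA : symmetric_set A.
  by apply: symmetric_image; exact: symmetric_conjugate_closure.
have AJ x y : A x -> A (x ^ y) by rewrite AE; exact: conjugate_closureJ.
have genA : generated_subgroup A = [set: G] by rewrite AE.
(* The product of the ball in [F] with [N] is the full preimage of the ball in [G]: a shortest word
   for [p x] lifts to some [b], and [b^-1 * x] lies in [N]. *)
have ballP m x : set_mul (word_ball (conjugate_closure S) m) N x <->
    normN (p x) <= m.
  have symF := symmetric_conjugate_closure symS.
  split=> [[b /(word_ballP symF)[k le_m wb] [n Nn <-]]|le_m].
    have <- : p b = p (b * n) by apply/quotient_projP; rewrite mulKg.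
    by apply: leq_trans le_m; apply: word_norm_le; apply/words_image; exists b.
  have /words_image[b wb pbx] := words_word_norm symA genA (p x).
  exists b; first by apply/(word_ballP symF); exists (normN (p x)).
  by exists (b^-1 * x); [apply/quotient_projP | rewrite mulVKg].
have c2_3 : cond2 -> cond3.
  move=> rf m; apply/closed_profiniteP => g /= /negP; rewrite -ltnNge => lt_mg.
  (* Testing [g] against the value [m] keeps the norm of [f g] above [m]; as [f] is metric, every
     element of the fibre through [g] then has norm above [m]. *)
  have [||C [l [f [_ f_metric [_ _ f_isom]]]]] :=
      rf [set g] [set 0%R; m%:R%R] (finite_set1 g) (finite_set2 _ _).
  - by move=> q /= [->|->]; rewrite ?lexx ?ler0n.
  - by left.
  exists [set x | f x = 1]; split.
  - exact: normal_subgroup_kernel.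
  - exact: finite_index_kernel.
  move=> y /multiplicative_eq fgy le_ym.
  have [_ [+ _] _] := f_isom g m%:R%R erefl (or_intror erefl).
  rewrite ratr_nat ltr_nat => /(_ lt_mg); rewrite fgy ltNge => /negP; apply.
  by apply: le_trans (f_metric y) _; rewrite ler_nat.
have c3_4 : cond3 -> cond4.
  move=> closedB m w nwB.
  have [|K [nK Kf KB]] := (closed_profiniteP _).1 (closedB m) (p w).
    by move=> /= le_m; apply: nwB; apply/ballP.
  (* The homomorphism sought is the composite of [p] with the projection of [G] modulo [K]; it kills
     [N] because [p] does. *)
  have [C [f [_ fE]]] := finite_quotient nK Kf.
  exists C, (f \o p); split.
    move=> [x /ballP xB /= fxw]; apply: KB xB.
    by apply/fE/esym.
  have p1 n : (N : set F) n -> p n = 1.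
    move=> Nn; rewrite -(multiplicative1 p); apply/esym/quotient_projP.
    by rewrite invg1 mul1g.
  apply/seteqP; split=> [_ [n Nn <-]|_ ->] /=.
    by rewrite p1 // multiplicative1.
  exists 1; last by rewrite /= !multiplicative1.
  by have [[]] := normal_carrierP N.
have c4_2 : cond4 -> cond2.
  move=> sepF; apply: metrically_RF_separated => // g.
  case norm_g: (normN g) => [|m].
    exists [set: G]; split; [exact: normal_subgroupT | exact: finite_indexT |].
    by rewrite -/(normN g) norm_g.
  have [w pw] := p_surj g.
  (* The norm of [g] is [m.+1], so its lift [w] lies just outside the set for radius [m]. *)
  have [|C [f [fw _]]] := sepF m w; first by move/ballP; rewrite pw norm_g ltnn.
  exists (p @` [set x | f x = 1]); split.
  - exact/normal_subgroup_image/normal_subgroup_kernel.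
  - exact/finite_index_image/finite_index_kernel.
  (* Here y is the image of [w * u] with [f u = 1]. Were its norm at most [m], then [w * u] would
     lie in the excluded set and have the same image as [w]. *)
  move=> y [u fu pu]; rewrite -/(normN g) -/(normN y) norm_g ltnNge.
  apply/negP => le_ym; apply: fw; exists (w * u); last first.
    by rewrite gmulfM fu mulg1.
  by apply/ballP; rewrite gmulfM pw pu mulVKg.
have c2_1 : cond2 -> cond1.
  move=> rf D Q Df Qf Q0 Q_0; have [C [l [f [? _ ?]]]] := rf D Q Df Qf Q0 Q_0.
  by exists C, l, f.
split=> //; first by move=> /c4_2.
move=> Sf; split=> // rf D Q Df Qf Q0 Q_0.
have [||||C [l [f [l_norm [f_inj f_mul f_isom]]]]] :=
    rf (D `|` p @` S) (Q `|` [set 1%R]).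
- by rewrite finite_setU; split=> //; exact: finite_image.
- by rewrite finite_setU; split.
- by move=> q [/Q0//|->] /=; exact: ler01.
- by left.
exists C, l, f; split=> //.
- move=> x; apply: (@invariant_norm_words _ _ _ (f @` A)) => //; last first.
    by apply/words_image; exists x => //; exact: words_word_norm.
  rewrite AE => _ [_ [_ [s Ss <-] [y _ <-]] <-].
  have [_ _ _ _ lJ] := l_norm.
  (* Invariance of [l] reduces a conjugate to [f (p s)]. A value above 1 there would force [p s] to
     have norm above 1, although it is a word of one letter. *)
  rewrite multiplicativeJ /conjg mulgA lJ leNgt; apply/negP.
  have ps : (D `|` p @` S) (p s) by right; exists s.
  have [_ [_ f_gt1] _] := f_isom (p s) 1%R ps (or_intror erefl).
  rewrite -[X in (X < _)%R](rmorph1 (@ratr R)) => /f_gt1.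
  rewrite rmorph1 ltr1n ltnNge => /negP; apply.
  apply: word_norm_le; apply: words1; exists s => //.
  by exists s => //; exists 1 => //; rewrite conjg1.
- split=> [h g /set_mem Dh /set_mem Dg|h g Dh Dg Dhg|g q Dg Qq].
  + by apply: f_inj; apply/mem_set; left.
  + exact: gmulfM.
  + by apply: f_isom; left.
Qed.
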